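(* Let $\{F_t\}_{t\in\mathbb{R}}$ be a properly ergodic flow on a standard $\sigma$-finite measure space $(X,\mathfrak{B},\mu)$ which satisfies Property B. Then $\{F_t\}_{t\in\mathbb{R}}$ is not approximately transitive.
   Context: A (measurable) flow on $(X,\mathfrak{B},\mu)$ is a one-parameter group $\{F_t\}_{t\in\mathbb{R}}$ of nonsingular automorphisms of $(X,\mathfrak{B},\mu)$ such that $X\times\mathbb{R}\ni(x,t)\mapsto F_t(x)\in X$ is measurable. It is ergodic if every $F_t$-invariant measurable set is null or conull, and properly ergodic if it is ergodic and no single orbit is conull. Property B: for $A\in\mathfrak{B}$ of positive measure and $s,\delta>0$ let $\Lambda_{F,\delta,s}(A)=\{x\in A:\ \exists t\in(e^{s-\delta},e^{s+\delta})\cup(-e^{s+\delta},-e^{s-\delta}),\ F_t(x)\in A\}$. The flow has Property B if there exists a measurable set $A\subseteq X$ of positive measure such that for all $\delta>0$, $\limsup_{s\to\infty}\mu(\Lambda_{F,\delta,s}(A))=0$. Approximate transitivity (AT, Connes–Woods): the flow is approximately transitive if for every $n\ge1$, all $f_1,\dots,f_n\in L^1_+(X,\mu)$ and every $\varepsilon>0$, there exist $f\in L^1_+(X,\mu)$, $m\ge 1$, $t_1,\dots,t_m\in\mathbb{R}$ and $\lambda_{jk}\ge0$ ($1\le j\le n$, $1\le k\le m$) such that $\left\|f_j-\sum_{k=1}^m\lambda_{jk}\,(f\circ F_{t_k})\,\frac{d\mu\circ F_{t_k}}{d\mu}\right\|_1\le\varepsilon$ for $j=1,\dots,n$. *)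

(* Defs.v *)
From HB Require Import structures.
From mathcomp Require Import all_boot all_order all_algebra.
From mathcomp Require Import all_classical all_reals all_analysis.

Set Implicit Arguments.
Unset Strict Implicit.
Unset Printing Implicit Defensive.

Import Order.TTheory GRing.Theory Num.Theory.
Import numFieldNormedType.Exports.

Local Open Scope classical_set_scope.
Local Open Scope ring_scope.

(* Completeness is spelled out because the library's [completeType] only
   extends pointed uniform spaces. *)
Definition polish (R : realType) (P : metricType R) : Prop :=
  (forall G : set_system P, ProperFilter G -> cauchy G ->
     exists l : P, G --> l) /\
  (exists2 D : set P, countable D & dense D).

Definition standard_borel (R : realType) d (T : measurableType d) : Prop :=
  exists (P : metricType R) (g : T -> P),
    [/\ polish P, bijective g &
        forall A : set T,
          measurable A <-> exists2 B : set P, <<s open >> B & A = g @^-1` B].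

Section flows.
Context (R : realType) (d : measure_display) (T : measurableType d).
Implicit Types (mu : {measure set T -> \bar R}) (F : R -> T -> T).

Definition nonsingular_flow mu F : Prop :=
  [/\ F 0 = id,
      forall s t, F (s + t) = F s \o F t,
      measurable_fun [set: T * R] (fun p => F p.2 p.1) &
      forall t (A : set T), measurable A ->
        mu (F t @^-1` A) = 0%E <-> mu A = 0%E].

Definition ergodic mu F : Prop :=
  forall A : set T, measurable A -> (forall t, F t @^-1` A = A) ->
    mu A = 0%E \/ mu (~` A) = 0%E.

Definition flow_orbit F (x : T) : set T := range (fun t => F t x).

Definition properly_ergodic mu F : Prop :=
  ergodic mu F /\ forall x, ~ mu.-negligible (~` flow_orbit F x).

Definition Lambda F (delta s : R) (A : set T) : set T :=
  [set x | A x /\ exists2 t : R,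
     (`]expR (s - delta), expR (s + delta)[ `|`
      `]- expR (s + delta), - expR (s - delta)[) t & A (F t x)].

(* [Lambda F delta s A] is a projection of a measurable subset of T * R, hence
   analytic but in general not in the sigma-algebra of T, where the value of the
   function [mu] is meaningless. The outer measure [mu_ext mu] is used instead:
   it agrees with [mu] on measurable sets and with the completion of [mu] on
   sets measurable for the completion, such as analytic ones. *)
Definition property_B mu F : Prop :=
  exists A : set T, [/\ measurable A, (0 < mu A)%E &
    forall delta : R, 0 < delta ->
      limf_esup (fun s : R => mu_ext mu (Lambda F delta s A)) (pinfty_nbhs R)
        = 0%E].

(* [D] is a version of d(mu o F_t)/dmu, where (mu o F_t)(A) = mu (F_t(A)). The
   library's Radon-Nikodym derivative is for finite [nu] only, whereas mu o F_t
   is merely sigma-finite. *)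
Definition is_RN_derivative mu (nu : set T -> \bar R) (D : T -> R) : Prop :=
  [/\ measurable_fun [set: T] D, forall x, 0 <= D x &
      forall A : set T, measurable A -> nu A = (\int[mu]_(x in A) (D x)%:E)%E].

(* Representatives of the elements of L^1_+; every class of an a.e. nonnegative
   function has an everywhere nonnegative representative. *)
Definition L1_plus mu (f : T -> R) : Prop :=
  f \in Lfun mu 1 /\ forall x, 0 <= f x.

Definition approximately_transitive mu F : Prop :=
  forall (n : nat) (f : 'I_n -> T -> R) (eps : R),
    (1 <= n)%N -> (forall j, L1_plus mu (f j)) -> 0 < eps ->
    exists (g : T -> R) (m : nat) (t : 'I_m -> R)
           (lambda : 'I_n -> 'I_m -> R) (D : 'I_m -> T -> R),
      [/\ L1_plus mu g,
          (1 <= m)%N,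
          forall j k, 0 <= lambda j k,
          forall k, is_RN_derivative mu (fun A => mu (F (t k) @` A)) (D k) &
          forall j,
            ('N[mu]_1 [EFin \o (fun x =>
               f j x - \sum_(k < m) lambda j k * g (F (t k) x) * D k x)%R]
             <= eps%:E)%E].

End flows.

(* Main.v *)
Require Import Defs.
From HB Require Import structures.
From mathcomp Require Import all_boot all_order all_algebra.
From mathcomp Require Import all_classical all_reals all_analysis.
From mathcomp Require Import measurable_realfun ring lra.

Set Implicit Arguments.
Unset Strict Implicit.
Unset Printing Implicit Defensive.

Import Order.TTheory GRing.Theory Num.Theory.
Import numFieldNormedType.Exports.
Local Open Scope classical_set_scope.
Local Open Scope ring_scope.

(** Write alpha_t g = (g o F_t) d(mu o F_t)/dmu for the translate of an
    integrable g >= 0: it is the distribution obtained by moving the mass g mu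
    by F_(-t).  Approximate transitivity, applied to the indicators of two
    subsets A1, A2 of a set A, gives one g and times t_k such that both
    indicators are close to combinations of the alpha_(t_k) g with nonnegative
    weights.  As the error is small, almost all the weight spent on A_j sits at
    times t_k for which most of alpha_(t_k) g lies in A_j; say that such times
    land in A_j ([lands_mass]).

    Let A be the set given by Property B, cut down to finite measure.  If t_k
    and c both land in A, then for at least half of the mass of g the point
    F_(-t_k) x is in A and comes back to A after the time t_k - c.  The set of
    points of A returning after a time comparable with d has tiny measure when d
    is large, so the times t_k with |t_k - c| comparable with d carry little
    weight ([annulus_mass]).

    Suppose moreover that the flow needs more than a large time M to go from A1
    to A2.  Let c land in A2 and, among the times landing in A1, let t_0 be the
    farthest from c, at distance d.  Then d > M ([lands_close]), and every other
    time landing in A1 is at distance at least d/2 and at most 3d/2 from c or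
    from t_0, because it is within d of c and |c - t_0| = d.  Two annuli of
    small weight thus exhaust the weight spent on A1, which is about mu A1: a
    contradiction.

    It remains to find A1 and A2 ([split_clusters]).  Remove from A the points
    that come back to A after a time between M and e^2 M; by Property B the rest
    E is most of A, and its points return to E only before M or after 2M.  So
    being at distance at most M along the flow is an equivalence relation on E,
    with classes (clusters) that are more than 2M apart.  A measurable map e
    that sends almost every point of E to a point of its orbit depending only on
    its cluster is obtained by an explicit average ([cluster_map]).  The image
    under e of mu restricted to E has no point masses, as a point mass would be
    carried by a single orbit, which proper ergodicity excludes
    ([orbit_subset_null]).  A measure without point masses on a countably
    separated space can be split into two comparable parts ([atomless_split]);
    their preimages in E are unions of clusters, hence far apart along the
    flow. *)

(** * Countably separated spaces and measures without point masses *)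

Definition separating_family (T : Type) (U : nat -> set T) : Prop :=
  forall x y, (forall i, U i x <-> U i y) -> x = y.

(** The family consists of the balls of radius 1/(n+1) around the points of a
    countable dense set.  Their interiors are used because they are open by
    construction. *)
Lemma standard_borel_separating (R : realType) d (T : measurableType d) :
  standard_borel R T ->
  exists U : nat -> set T, (forall i, measurable (U i)) /\ separating_family U.
Proof.
move=> [P [g [[_ [D cD dD]] bijg measE]]].
have /countable_injP[h injh] := cD.
pose r (n : nat) : R := n.+1%:R^-1.
have r0 n : 0 < r n by rewrite invr_gt0.
pose B (k : nat * nat) : set P :=
  \bigcup_(c in [set c | D c /\ h c = k.1]) (ball c (r k.2))°%classic.
(* The pair (h c, n) codes the ball of radius r n around c; h is injective, so
   the union in B has at most one term. *)
pose V (i : nat) := if unpickle i is Some k then B k else set0.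
exists (fun i => g @^-1` V i); split=> [i|x y xy].
  apply/measE; exists (V i) => //; apply: sub_sigma_algebra.
  rewrite /V; case: unpickle => [k|]; last exact: open0.
  by apply: bigcup_open => c _; exact: open_interior.
apply: (bij_inj bijg); apply/eqP/negPn; rewrite -mdist_gt0; apply/negP => gxy.
have [n nlt] : exists n, r n + r n < mdist (g x) (g y).
  have e0 : 0 < mdist (g x) (g y) / 2 by rewrite divr_gt0.
  exists (Num.truncn (mdist (g x) (g y) / 2)^-1).
  have := truncnS_gt (mdist (g x) (g y) / 2)^-1.
  rewrite -[X in _ < X]invrK ltf_pV2 ?posrE ?invr_gt0//.
  rewrite -/(r _) => rlt; rewrite [ltRHS]splitr; exact: ltrD.
have [c [Bc Dc]] : (ball (g x) (r n / 2))°%classic `&` D !=set0.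
  apply: dD; last exact: open_interior.
  by exists (g x); apply: nbhsx_ballx; rewrite divr_gt0.
have cx : ball c (r n / 2) (g x) by apply/ball_sym; exact: interior_subset Bc.
have Vx : V (pickle (h c, n)) (g x).
  rewrite /V pickleK; exists c => //=.
  apply/nbhs_ballP; exists (r n / 2); first by rewrite /= divr_gt0.
  move=> z xz; rewrite (splitr (r n)); exact: ball_triangle cx xz.
have : V (pickle (h c, n)) (g y) by apply/xy.
rewrite /V pickleK => -[c' /= [Dc' hcc'] /interior_subset Bc'y].
have ? : c' = c by apply: injh => //; exact/mem_set.
subst c'.
have : ball (g x) (r n / 2 + r n) (g y).
  by apply: ball_triangle Bc'y; exact/ball_sym.
by rewrite ballEmdist/=; have := r0 n; lra.
Qed.

(** Halve the space repeatedly along the U i, keeping the larger half.  The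
    measure at most halves at each step, so it cannot jump over the interval
    between one third and two thirds of the total; and it cannot stay above two
    thirds, since the intersection of the nested sets is at most a point. *)
Lemma atomless_split (R : realType) d (T : measurableType d)
    (nu : {measure set T -> \bar R}) (U : nat -> set T) :
  (nu setT < +oo)%E -> (forall i, measurable (U i)) -> separating_family U ->
  (forall Q, measurable Q -> is_subset1 Q -> nu Q = 0%E) ->
  exists V, [/\ measurable V, (nu setT <= 3%:E * nu V)%E &
                (nu setT <= 3%:E * nu (~` V))%E].
Proof.
move=> nuoo mU sepU nu0.
pose m A := fine (nu A).
have mE A : measurable A -> nu A = (m A)%:E.
  move=> mA; rewrite fineK// ge0_fin_numE// (le_lt_trans _ nuoo)//.
  by apply: le_measure; rewrite ?inE.
have m_ge0 A : 0 <= m A by rewrite fine_ge0.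
have mD A B : measurable A -> measurable B -> A `&` B = set0 ->
    m (A `|` B) = m A + m B.
  move=> mA mB AB; apply: EFin_inj; rewrite EFinD -!mE//; last exact: measurableU.
  by rewrite measureU.
have mC A : measurable A -> m (~` A) = m setT - m A.
  move=> mA; rewrite -(setUv A) mD ?setICr//; last exact: measurableC.
  by rewrite addrC addKr.
pose step i Q := if m (Q `\` U i) <= m (Q `&` U i) then Q `&` U i else Q `\` U i.
pose Q := fix Q i := if i is j.+1 then step j (Q j) else setT.
have mQ i : measurable (Q i).
  elim: i => //= i IH; rewrite /step; case: ifP => _.
    exact: measurableI. exact: measurableD.
have QS i : Q i.+1 `<=` Q i by move=> x /=; rewrite /step; case: ifP => _ [].
have half i : m (Q i) <= 2 * m (Q i.+1).
  have -> : m (Q i) = m (Q i `&` U i) + m (Q i `\` U i).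
    rewrite -mD ?setUIDK//; [exact: measurableI|exact: measurableD|].
    by rewrite setDE setIACA setICr setI0.
  by rewrite /= /step; case: (leP (m (Q i `\` U i)) (m (Q i `&` U i))) => ?; lra.
pose c := m setT.
have [[i /andP[lo hi]]|no] :=
    pselect (exists i, (c <= 3 * m (Q i)) && (3 * m (Q i) <= 2 * c)).
  have mQC := measurableC (mQ i).
  exists (Q i); rewrite (mE setT)// (mE (Q i))// (mE (~` Q i))//.
  rewrite -!EFinM !lee_fin mC// -/c; split => //. lra.
have big i : 2 * c <= 3 * m (Q i).
  elim: i => [|i IH]; first by have := m_ge0 setT; rewrite /= /c; lra.
  rewrite leNgt; apply/negP => lt; apply: no; exists i.+1.
  by have := half i; have := m_ge0 setT; rewrite -/c; move: lt IH => /=; lra.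
have cvQ : nu (Q i) @[i --> \oo] --> nu (\bigcap_i Q i).
  apply: nonincreasing_cvg_mu => //.
  - exact: bigcap_measurable.
  - by apply/nonincreasing_seqP => i; rewrite subsetEset; exact: QS.
have sub1 : is_subset1 (\bigcap_i Q i).
  move=> x y Qx Qy; apply: sepU => i.
  have := Qx i.+1 I; have := Qy i.+1 I; rewrite /= /step.
  by case: ifP => _ [_ +] [_ +] => ? ?; split.
rewrite nu0// in cvQ; last exact: bigcap_measurable.
have c0 : c <= 0.
  have cv3 : (3%:E * nu (Q i))%E @[i --> \oo] --> (3%:E * 0)%E by exact: cvgeZl.
  rewrite mule0 in cv3.
  have : ((2 * c)%:E <= limn (fun i => 3%:E * nu (Q i)))%E.
    apply: lime_ge; first by apply/cvg_ex; eexists; exact: cv3.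
    by apply: nearW => i; rewrite mE// -EFinM lee_fin.
  by rewrite (cvg_lim _ cv3)// lee_fin; lra.
by exists set0; split => //; rewrite (@mE setT)// (le_trans (y:=0%:E)) ?lee_fin// mule_ge0.
Qed.

(** Sets of returning points are analytic and need not be measurable; all
    estimates are made on a measurable cover instead. *)
Lemma mu_ext_lt_cover (R : realType) d (T : measurableType d)
    (mu : {measure set T -> \bar R}) (X : set T) (e : \bar R) :
  (mu_ext mu X < e)%E ->
  exists L, [/\ measurable L, X `<=` L & (mu L < e)%E].
Proof.
move=> /ereal_inf_lt[_ [A [mA XA] <-] lt]; exists (\bigcup_i A i); split => //.
  exact: bigcup_measurable.
apply: le_lt_trans lt; apply: generalized_Boole_inequality => //; exact: bigcup_measurable.
Qed.

(** * Visit times along the flow *)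

Section lebesgue_translation.
Variable R : realType.
Local Notation leb := (@lebesgue_measure R).

Lemma measurable_translation (u : R) :
  measurable_fun [set: measurableTypeR R]
    (fun t : R => t + u : measurableTypeR R).
Proof. exact: (@measurable_funD _ R R setT id (cst u)). Qed.

Lemma lebesgue_measure_translation (u : R) (A : set R) : measurable A ->
  leb ((fun t => t + u) @^-1` A) = leb A.
Proof.
move=> mA.
pose mphi := isMeasurableFun.Build _ _ _ _ _ (measurable_translation u).
pose phi : {mfun measurableTypeR R >-> measurableTypeR R} :=
  HB.pack (fun t : R => t + u) mphi.
apply/esym; apply: (@lebesgue_measure_unique R (pushforward leb phi)) => //.
move=> _ [[a b]] _ <-; transitivity (leb `]a - u, b - u]%classic).
  rewrite !lebesgue_measure_itv/= !lte_fin ltrD2r; case: ifP => // _.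
  by rewrite -!EFinB; congr EFin; ring.
congr (leb _); apply/seteqP; split=> t /=.
all: by rewrite !in_itv/= => /andP[? ?]; apply/andP; split; lra.
Qed.

Lemma ge0_integral_translation (u : R) (f : R -> \bar R) :
  measurable_fun [set: measurableTypeR R] f -> (forall t, 0 <= f t)%E ->
  (\int[leb]_t f (t + u)%R = \int[leb]_t f t)%E.
Proof.
move=> mf f0.
have := @ge0_integral_pushforward _ _ _ _ _ _ (measurable_translation u) leb
  setT f measurableT mf (fun y _ => f0 y).
rewrite preimage_setT /= => <-.
apply: eq_measure_integral => [|mt A mA _]; first exact: measurable_translation.
exact: lebesgue_measure_translation.
Qed.

End lebesgue_translation.

Section flow.
Context (R : realType) (d : measure_display) (T : measurableType d).
Variables (mu : {sigma_finite_measure set T -> \bar R}) (F : R -> T -> T).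
Hypothesis flowF : nonsingular_flow mu F.
Local Notation leb := (@lebesgue_measure R).

Lemma flow0 x : F 0 x = x.
Proof. by case: flowF => ->. Qed.

Lemma flowD s t x : F (s + t) x = F s (F t x).
Proof. by case: flowF => _ /(_ s t) ->. Qed.

Lemma flowNK t : cancel (F t) (F (- t)).
Proof. by move=> x; rewrite -flowD addNr flow0. Qed.

Lemma flowKN t : cancel (F (- t)) (F t).
Proof. by move=> x; rewrite -flowD addrN flow0. Qed.

Lemma measurable_joint : measurable_fun [set: T * measurableTypeR R] (fun p => F p.2 p.1).
Proof. by case: flowF. Qed.

Lemma measurable_flow t : measurable_fun setT (F t).
Proof.
have -> : F t = (fun p => F p.2 p.1) \o (fun x : T => (x, t : measurableTypeR R)) by [].
apply: measurableT_comp; first exact: measurable_joint.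
exact: pair2_measurable.
Qed.

Lemma measurable_flow_preimage t A : measurable A -> measurable (F t @^-1` A).
Proof. by move=> mA; rewrite -[X in measurable X]setTI; exact: measurable_flow. Qed.

Lemma flow_null t A : measurable A -> mu (F t @^-1` A) = 0%E <-> mu A = 0%E.
Proof. by case: flowF => _ _ _; exact. Qed.

Definition visits (D : set R) (E : set T) : set (T * measurableTypeR R) :=
  [set p | D p.2 /\ E (F p.2 p.1)].

Lemma measurable_visits (D : set R) (E : set T) :
  measurable D -> measurable E -> measurable (visits D E).
Proof.
move=> mD mE.
have -> : visits D E = (setT `*` D) `&` (fun p => F p.2 p.1) @^-1` E.
  by apply/seteqP; split=> -[x t] /=; rewrite /visits/= => -[]; [move=> ? ?|move=> [_ ?] ?].
apply: measurableI; first exact: measurableX.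
by rewrite -[X in measurable X]setTI; exact: measurable_joint.
Qed.

Definition visit_time (M : R) (E : set T) (x : T) : \bar R :=
  leb (xsection (visits `[- M, M]%classic E) x).

Lemma measurable_visit_time M E : measurable E ->
  measurable_fun setT (visit_time M E).
Proof.
move=> mE; apply: measurable_fun_xsection; apply: measurable_visits => //.
Qed.

(** Let N be the set of points of E whose visits to E during [-M, M] take no
    time.  Along each orbit the visits to N during [0, M] take no time: seen
    from one of them, the others are visits to E within M.  By Tonelli,
    mu (F_t^-1 N) = 0 for some t, and the flow is nonsingular. *)
Lemma mu_no_visit_time M E : 0 < M -> measurable E ->
  mu (E `&` visit_time M E @^-1` [set 0%E]) = 0%E.
Proof.
move=> M0 mE; set N := _ `&` _.
have mN : measurable N.
  apply: measurableI => //; rewrite -[X in measurable X]setTI.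
  exact: measurable_visit_time.
pose W := visits `[0, M]%classic N.
have mW : measurable W by exact: measurable_visits.
have x0 x : leb (xsection W x) = 0%E.
  have [->|/set0P[t0 /xsectionP[t0M Nt0]]] := eqVneq (xsection W x) set0.
    by rewrite measure0.
  rewrite /= in_itv/= in t0M.
  (* From here on, times are counted from the visit at t0. *)
  have [_ /= Z0] := Nt0; rewrite /visit_time in Z0.
  have mZ : measurable (xsection (visits `[- M, M]%classic E) (F t0 x)).
    by apply: measurable_xsection; exact: measurable_visits.
  apply: (@subset_measure0 _ _ _ leb _
    ((fun t => t + - t0) @^-1` (xsection (visits `[- M, M]%classic E) (F t0 x)))).
  - exact: measurable_xsection.
  - by rewrite -[X in measurable X]setTI; exact: measurable_translation.
  - move=> t /xsectionP[/= tM [Et _]]; apply/xsectionP; split => /=.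
      by move: tM; rewrite !in_itv/=; lra.
    by rewrite -flowD subrK.
  - exact: etrans (lebesgue_measure_translation _ mZ) Z0.
have y0 : (\int[leb]_t mu (ysection W t) = 0)%E.
  rewrite (_ : (fun t => mu _) = fubini_G mu (EFin \o \1_W)); last first.
    by rewrite indic_fubini_tonelli_GE.
  rewrite -(indic_fubini_tonelli mu leb mW) indic_fubini_tonelli_FE//.
  by apply: integral0_eq => x _; exact: x0.
have ae0 : ae_eq leb setT (fun t => mu (ysection W t)) (cst 0%E).
  apply/ae_eq_integral_abs => //; first exact: measurable_fun_ysection.
  by rewrite -[RHS]y0; apply: eq_integral => t _; rewrite gee0_abs.
apply: contrapT => N0.
have : leb `[0, M]%classic = 0%E.
  apply/negligibleP => //; apply: negligibleS ae0 => t tM /=.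
  move=> /(_ Logic.I); apply/eqP; apply: contra_notN N0 => /eqP.
  have -> : ysection W t = F t @^-1` N.
    by apply/seteqP; split => x; rewrite /ysection/= ?inE; [case|].
  by move/flow_null; exact.
by rewrite lebesgue_measure_itv/= lte_fin M0 => -[]; lra.
Qed.

End flow.

(** * Clusters *)

Section clusters.
Context (R : realType) (d : measure_display) (T : measurableType d).
Variables (mu : {sigma_finite_measure set T -> \bar R}) (F : R -> T -> T).
Hypothesis flowF : nonsingular_flow mu F.
Local Notation leb := (@lebesgue_measure R).

Let kern (M : R) (E : set T) (p : T * measurableTypeR R) : \bar R :=
  (expR p.2 * \1_(visits F `[(- M)%R, M]%classic E) p)%:E.

(** The weight e^t makes ln (visit_weight M E x) a mean time of visit, in the
    sense that it drops by u when the origin moves from x to F_u x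
    ([visit_weight_flow]).  Unlike a supremum of the times of visit, it is
    measurable in x by Tonelli. *)
Definition visit_weight (M : R) (E : set T) (x : T) : \bar R :=
  (\int[leb]_t kern M E (x, t))%E.

Let kern_ge0 M E p : (0 <= kern M E p)%E.
Proof. by rewrite lee_fin mulr_ge0 ?expR_ge0. Qed.

Let measurable_kern M E : measurable E ->
  measurable_fun [set: T * measurableTypeR R] (kern M E).
Proof.
move=> mE; apply/measurable_EFinP; apply: measurable_funM.
  apply: measurableT_comp; first exact: measurable_expR.
  exact: measurable_snd.
by apply: measurable_indic; apply: (measurable_visits flowF).
Qed.

Lemma measurable_visit_weight M E : measurable E ->
  measurable_fun setT (visit_weight M E).
Proof.
move=> mE; apply: (@measurable_fun_fubini_tonelli_F _ _ _ _ _ leb (kern M E)) => //.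
exact: measurable_kern.
Qed.

Lemma visit_weight_fin (M : R) E x : 0 < M -> measurable E ->
  visit_weight M E x \is a fin_num.
Proof.
move=> M0 mE; rewrite ge0_fin_numE; last exact: integral_ge0.
have : (visit_weight M E x <= \int[leb]_(t in `[(- M)%R, M]%classic) (expR M)%:E)%E.
  rewrite [leRHS]integral_mkcond; apply: ge0_le_integral => //.
  - by exact: measurable_fun_pair2 (measurable_kern M mE).
  - apply: (measurable_restrictT _ _).1 => //.
  move=> t _; rewrite /kern patchE/= indicE.
  case: ifPn => [|tM].
    rewrite inE/= in_itv/= => /andP[_ tM].
    by rewrite lee_fin -[leRHS]mulr1 ler_pM ?expR_ge0// ?ler_expR// lern1 leq_b1.
  by rewrite memNset ?mulr0// => -[/= tM' _]; rewrite mem_set in tM.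
move/le_lt_trans; apply.
rewrite integral_cst//= lebesgue_measure_itv/= lte_fin.
by case: ifP => _; rewrite -?EFinB -?EFinM ?ltry// mule0 ltry.
Qed.

Lemma visit_weight_gt0 M E x : measurable E -> visit_time F M E x != 0%E ->
  (0 < visit_weight M E x)%E.
Proof.
move=> mE t0.
have mZ : measurable (xsection (visits F `[(- M)%R, M]%classic E) x).
  by apply: measurable_xsection; exact: (measurable_visits flowF).
apply: (@lt_le_trans _ _ (\int[leb]_t
   ((expR (- M)%R)%:E * (\1_(xsection (visits F `[(- M)%R, M]%classic E) x) t)%:E))%E).
  rewrite ge0_integralZl//; last exact/measurable_EFinP/measurable_indic.
  rewrite integral_indic// setIT mule_gt0 ?lte_fin ?expR_gt0//.
  by rewrite lt_neqAle eq_sym t0 measure_ge0.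
apply: ge0_le_integral => //.
- by apply: emeasurable_funM => //; exact/measurable_EFinP/measurable_indic.
- by exact: measurable_fun_pair2 (measurable_kern M mE).
move=> t _; rewrite /kern -EFinM lee_fin !indicE.
have -> : (t \in xsection (visits F `[(- M)%R, M]%classic E) x) =
          ((x, t) \in visits F `[(- M)%R, M]%classic E).
  by rewrite mem_xsection.
case: (boolP (_ \in _)) => [|_]; last by rewrite !mulr0.
by rewrite inE => -[/=]; rewrite in_itv/= => /andP[Mt _] _; rewrite !mulr1 ler_expR.
Qed.

(** The hypothesis says that the windows of radius M around x and around F_u x
    contain the same visits to E. *)
Lemma visit_weight_flow M E x u : measurable E ->
  (forall t, (`|t| <= M /\ E (F (t + u) x)) <-> (`|t + u| <= M /\ E (F (t + u) x))) ->
  visit_weight M E (F u x) = ((expR (- u)%R)%:E * visit_weight M E x)%E.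
Proof.
move=> mE same.
have mk : measurable_fun setT (fun t => kern M E (x, t)).
  exact: measurable_fun_pair2 (measurable_kern M mE).
rewrite -ge0_integralZl// -[RHS](@ge0_integral_translation R u); last 2 first.
- exact: measurable_funeM.
- by move=> t; rewrite mule_ge0// lee_fin expR_ge0.
apply: eq_integral => t _; rewrite /kern -EFinM /= mulrA -expRD.
rewrite addrC addrK !indicE; congr (_ * _%:R)%:E; congr nat_of_bool.
have H s y : ((y, s) \in visits F `[(- M)%R, M]%classic E) = (`|s| <= M) && `[< E (F s y) >].
  apply/idP/idP => [|/andP[sM /asboolP Es]].
    by rewrite inE => -[/=]; rewrite in_itv/= -ler_norml => -> /asboolP.
  by rewrite inE; split => //=; rewrite in_itv/= -ler_norml.
rewrite !H -(flowD flowF).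
have [tu ut] := same t.
apply/idP/idP => /andP[h /asboolP Et].
  by have [h' _] := tu (conj h Et); rewrite h'; exact/asboolP.
by have [h' _] := ut (conj h Et); rewrite h'; exact/asboolP.
Qed.

(** A point x with visit weight w x is sent to F_(ln (w x)) x, its position at
    the mean time of the visits to E in its cluster.  The window has radius 2M
    so that, seen from any point of a cluster, it contains the whole cluster and
    nothing else.  The points of E without visit time, where w vanishes, are
    removed; they form a null set. *)
Lemma cluster_map (M : R) E : 0 < M -> measurable E ->
  (forall x t, E x -> E (F t x) -> `|t| <= 2 * M -> `|t| <= M) ->
  exists (E' : set T) (e : T -> T),
  [/\ measurable E', E' `<=` E, mu E' = mu E, measurable_fun setT e &
      (forall x, exists t, e x = F t x) /\
      (forall x u, E' x -> E' (F u x) -> `|u| <= M -> e (F u x) = e x)].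
Proof.
move=> M0 mE gap; have M20 : 0 < 2 * M by rewrite mulr_gt0.
pose N := E `&` visit_time F (2 * M) E @^-1` [set 0%E].
have mN : measurable N.
  apply: measurableI => //; rewrite -[X in measurable X]setTI.
  exact: (measurable_visit_time flowF).
pose w := visit_weight (2 * M) E.
have mw : measurable_fun setT w by exact: measurable_visit_weight.
exists (E `\` N), (fun x => F (ln (fine (w x))) x).
have finw x : w x \is a fin_num by exact: visit_weight_fin.
split; first exact: measurableD.
- by move=> x [].
- rewrite [RHS](measureDI mu mE mN).
  rewrite (_ : E `&` N = N); last by rewrite /N setIA setIid.
  by rewrite [X in (_ = _ + X)%E](mu_no_visit_time flowF M20 mE) adde0.
- have -> : (fun x => F (ln (fine (w x))) x) =
      (fun p : T * R => F p.2 p.1) \o (fun x => (x, ln (fine (w x)))) by [].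
  case: flowF => _ _ mF _; apply: measurableT_comp => //.
  apply: measurable_fun_pair => //; apply: measurableT_comp => //.
  exact: measurableT_comp.
split=> [x|x u [Ex xN] [Eux uxN] uM]; first by exists (ln (fine (w x))).
have w0 : 0 < fine (w x).
  rewrite -lte_fin fineK//; apply: visit_weight_gt0 => //.
  by apply/eqP => x0; apply: xN.
have -> : w (F u x) = ((expR (- u)%R)%:E * w x)%E.
  apply: visit_weight_flow => // t; split=> -[tM Et]; split => //.
    have : `|t| <= M by apply: (gap (F u x)) => //; rewrite -(flowD flowF).
    by move=> tM'; rewrite (le_trans (ler_normD _ _))//; lra.
  have : `|t + u| <= M by apply: (gap x).
  by move=> tM'; have := ler_normB (t + u) u; rewrite addrK; lra.
rewrite fineM// lnM ?posrE ?expR_gt0// expRK -(flowD flowF).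
by congr (F _ x); ring.
Qed.

End clusters.

(** * Sets that are far apart along the flow *)

Section splitting.
Context (R : realType) (d : measure_display) (T : measurableType d).
Variables (mu : {sigma_finite_measure set T -> \bar R}) (F : R -> T -> T).
Hypotheses (flowF : nonsingular_flow mu F) (ergF : properly_ergodic mu F).
Local Notation leb := (@lebesgue_measure R).

(** The points whose orbit spends positive time in P form an exactly invariant
    measurable set Q, contained in the orbit of z.  By ergodicity Q is null or
    conull; if it were conull, so would be the orbit.  Almost every point of P is
    in Q. *)
Lemma orbit_subset_null P z : measurable P -> P `<=` flow_orbit F z ->
  mu P = 0%E.
Proof.
move=> mP Pz; have [erg noorb] := ergF.
pose f x := leb (xsection (visits F setT P) x).
have mV : measurable (visits F setT P) by exact: (measurable_visits flowF).
have mf : measurable_fun setT f by exact: measurable_fun_xsection.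
have fF t x : f (F t x) = f x.
  rewrite /f -(@lebesgue_measure_translation _ t (xsection _ x)); last first.
    exact: measurable_xsection.
  congr (leb _); apply/seteqP; split=> s.
    by move=> /xsectionP[/= _ Ps]; apply/xsectionP; split => //=; rewrite (flowD flowF).
  by move=> /xsectionP[/= _ Ps]; apply/xsectionP; split => //=; rewrite -(flowD flowF).
have mQ : measurable (f @^-1` [set~ 0%E]).
  by rewrite -[X in measurable X]setTI; apply: mf => //; exact: measurableC.
have [|Q0|Q0] := erg _ mQ.
- by move=> t; apply/seteqP; split=> x /=; rewrite fF.
- apply: (@subset_measure0 _ _ _ mu _
    (f @^-1` [set~ 0%E] `|` (P `&` visit_time F 1 P @^-1` [set 0%E]))) => //.
  + apply: measurableU => //; apply: measurableI => //.
    rewrite -[X in measurable X]setTI.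
    exact: (measurable_visit_time flowF).
  + move=> x Px; have [v0|v0] := pselect (visit_time F 1 P x = 0%E); [by right|left].
    move=> /= fx0; apply: v0.
    apply: (@subset_measure0 _ _ _ leb _ (xsection (visits F setT P) x)) => //.
    * by apply: measurable_xsection; exact: (measurable_visits flowF).
    * exact: measurable_xsection.
    * by move=> s /xsectionP[_ Ps]; exact/xsectionP.
  + apply: (etrans (measureU0 mQ _ _) Q0); last exact: (mu_no_visit_time flowF).
    apply: measurableI => //; rewrite -[X in measurable X]setTI.
    exact: (measurable_visit_time flowF).
- exfalso; apply: (noorb z); apply: (@negligibleS _ _ _ mu (~` (f @^-1` [set~ 0%E]))).
  + apply: subsetC => x /= /eqP fx0.
    have [fe|/set0P[s /xsectionP[/= _ /Pz[r _ /= Frz]]]] :=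
      eqVneq (xsection (visits F setT P) x) set0.
      by rewrite /f fe measure0 eqxx in fx0.
    exists (- s + r) => //=; rewrite (flowD flowF) Frz; exact: (flowNK flowF).
  + by apply/negligibleP => //; exact: measurableC.
Qed.

(** Both sets are inverse images under the cluster map, so a time of at most M
    cannot lead from one to the other. *)
Lemma split_clusters (M : R) E : standard_borel R T -> 0 < M -> measurable E ->
  (mu E < +oo)%E ->
  (forall x t, E x -> E (F t x) -> `|t| <= 2 * M -> `|t| <= M) ->
  exists A1 A2 : set T,
  [/\ measurable A1 /\ measurable A2, A1 `<=` E /\ A2 `<=` E,
      (mu E <= 3%:E * mu A1)%E, (mu E <= 3%:E * mu A2)%E &
      forall x u, A1 x -> A2 (F u x) -> M < `|u|].
Proof.
move=> /standard_borel_separating[U [mU sepU]] M0 mE Eoo gap.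
have [E' [e [mE' E'E muE' me [eorb einv]]]] := cluster_map flowF M0 mE gap.
(* The image under e of the restriction of mu to E'. *)
have [nu nuE] : exists nu : {measure set T -> \bar R},
    forall A, nu A = mu (e @^-1` A `&` E').
  pose nu : {measure set T -> \bar R} := pushforward (mrestr mu mE') e.
  by exists (nu me).
have [|Q mQ Q1|V [mV]] := @atomless_split R d T nu U _ mU sepU.
- by rewrite nuE preimage_setT setTI muE'.
- rewrite nuE; have mP : measurable (e @^-1` Q `&` E').
    by apply: measurableI => //; rewrite -[X in measurable X]setTI; exact: me.
  have [->|/set0P[x0 [Qx0 _]]] := eqVneq (e @^-1` Q `&` E') set0; first exact: measure0.
  apply: (orbit_subset_null (z := e x0)) => // x [Qx _].
  have [t ext] := eorb x; exists (- t) => //=.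
  by rewrite (Q1 _ _ Qx0 Qx) ext (flowNK flowF).
rewrite !nuE preimage_setT setTI muE' => V1 V2.
have mpre A : measurable A -> measurable (e @^-1` A `&` E').
  by move=> mA; apply: measurableI => //; rewrite -[X in measurable X]setTI; exact: me.
exists (e @^-1` V `&` E'), (e @^-1` (~` V) `&` E'); split => //.
- by split; apply: mpre => //; exact: measurableC.
- by split=> x [_ /E'E].
- move=> x u [Vx E'x] [/= nVu E'u]; rewrite ltNge; apply/negP => uM.
  by apply: nVu; rewrite einv.
Qed.

End splitting.

(** * Moving mass along the flow *)

Section layer_cake.
Context (R : realType) (d : measure_display) (T : measurableType d).
Variable mu : {sigma_finite_measure set T -> \bar R}.
Local Notation leb := (@lebesgue_measure R).

Let subgraph (h : T -> R) : set (T * measurableTypeR R) :=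
  [set p | 0 <= p.2 /\ p.2 < h p.1].

Let measurable_subgraph h : measurable_fun setT h -> measurable (subgraph h).
Proof.
move=> mh.
have -> : subgraph h =
    (snd @^-1` `[0, +oo[%classic) `&` (fun p => p.2 < h p.1) @^-1` [set true].
  by apply/seteqP; split=> -[x t] /=; rewrite /subgraph/= in_itv/= andbT.
have mi : measurable (`[0, +oo[%classic : set R) by exact: measurable_itv.
apply: measurableI; rewrite -[X in measurable X]setTI.
  exact: (@measurable_snd _ _ T (measurableTypeR R) measurableT _ mi).
have m2 : measurable_fun setT (fun p : T * measurableTypeR R => p.2 : R).
  exact: (@measurable_snd _ _ T (measurableTypeR R)).
have m1 : measurable_fun setT (fun p : T * measurableTypeR R => h p.1).
  apply: measurableT_comp => //; exact: (@measurable_fst _ _ T (measurableTypeR R)).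
exact: (measurable_fun_ltr m2 m1).
Qed.

Let subgraph_section h x : 0 <= h x -> leb (xsection (subgraph h) x) = (h x)%:E.
Proof.
move=> h0; have -> : xsection (subgraph h) x = `[0, h x[%classic.
  by apply/seteqP; split=> t; rewrite xsectionE/= in_itv/= => /andP.
rewrite lebesgue_measure_itv/= lte_fin oppr0 adde0.
by have [//|h0'] := ltP 0 (h x); rewrite (le_anti (introT andP (conj h0' h0))).
Qed.

(** Both sides are integrals over r >= 0 of the measures of the layers, by
    Tonelli applied to the subgraphs of h and of k. *)
Lemma ge0_integral_weighted_layers (h k D : T -> R) :
  measurable_fun setT h -> measurable_fun setT k -> measurable_fun setT D ->
  (forall x, 0 <= h x) -> (forall x, 0 <= k x) -> (forall x, 0 <= D x) ->
  (forall r, 0 <= r -> mu [set x | r < k x] =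
                       (\int[mu]_(x in [set x | (r < h x)%R]) (D x)%:E)%E) ->
  (\int[mu]_x (h x * D x)%:E = \int[mu]_x (k x)%:E)%E.
Proof.
move=> mh mk mD h0 k0 D0 layer.
have mH := measurable_subgraph mh; have mK := measurable_subgraph mk.
pose f (p : T * measurableTypeR R) : \bar R := (D p.1 * \1_(subgraph h) p)%:E.
have f0 p : (0 <= f p)%E by rewrite lee_fin mulr_ge0.
have mf : measurable_fun setT f.
  apply/measurable_EFinP; apply: measurable_funM; last exact: measurable_indic.
  by apply: measurableT_comp => //; exact: measurable_fst.
have sec x : (\int[leb]_t f (x, t) = (h x * D x)%:E)%E.
  rewrite (eq_integral (fun t => (D x)%:E * (\1_(xsection (subgraph h) x) t)%:E)%E); last first.
    by move=> t _; rewrite /f EFinM !indicE mem_xsection.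
  have mS : measurable (xsection (subgraph h) x) by exact: measurable_xsection.
  have mI := measurable_indic mS (R := R).
  rewrite ge0_integralZl ?lee_fin//; last exact/measurable_EFinP/measurable_indic.
  rewrite integral_indic// setIT [X in (_ * X)%E](subgraph_section (h0 x)).
  by rewrite -EFinM mulrC.
under eq_integral do rewrite -sec.
rewrite (@fubini_tonelli _ _ _ _ _ mu leb f)//.
transitivity (\int[leb]_t mu (ysection (subgraph k) t))%E.
  apply: eq_integral => t _; have [t0|t0] := leP 0 t.
    have -> : ysection (subgraph k) t = [set x | t < k x].
      by apply/seteqP; split=> x; rewrite ysectionE/= ?/subgraph/=; [case|].
    rewrite layer// [RHS]integral_mkcond; apply: eq_integral => x _.
    rewrite /f patchE indicE; have [th|th] := pselect (t < h x).
      by rewrite !mem_set//= mulr1.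
    by rewrite !memNset//= ?mulr0// => -[].
  have -> : ysection (subgraph k) t = set0.
    by apply/seteqP; split=> x; rewrite ysectionE//= => -[/=]; rewrite leNgt t0.
  rewrite measure0; apply: integral0_eq => x _.
  by rewrite /f indicE memNset ?mulr0// => -[/=]; rewrite leNgt t0.
have := indic_fubini_tonelli mu leb mK.
rewrite indic_fubini_tonelli_FE// indic_fubini_tonelli_GE// => /= <-.
by apply: eq_integral => x _; exact: subgraph_section.
Qed.

End layer_cake.

Section transport.
Context (R : realType) (d : measure_display) (T : measurableType d).
Variables (mu : {sigma_finite_measure set T -> \bar R}) (F : R -> T -> T).
Hypothesis flowF : nonsingular_flow mu F.

(** With D a version of d(mu o F_t)/dmu, the translate (g o F_t) D gives to B the
    mass that g gives to F_t B.  Only the values of mu o F_t on measurable sets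
    enter, through the layers of g restricted to F_t B. *)
Lemma integral_RN_flow t (D g : T -> R) B :
  is_RN_derivative mu (fun A => mu (F t @` A)) D ->
  measurable_fun setT g -> (forall x, 0 <= g x) -> measurable B ->
  (\int[mu]_(x in B) (g (F t x) * D x)%:E =
   \int[mu]_(x in F (- t) @^-1` B) (g x)%:E)%E.
Proof.
move=> [mD D0 DE] mg g0 mB.
have mB' := measurable_flow_preimage flowF (- t) mB.
pose k x := g x * \1_(F (- t) @^-1` B) x.
have mk : measurable_fun setT k by apply: measurable_funM => //; exact: measurable_indic.
have k0 x : 0 <= k x by rewrite mulr_ge0.
have mkF : measurable_fun setT (k \o F t).
  by apply: measurableT_comp => //; exact: (measurable_flow flowF).
rewrite integral_mkcond [RHS]integral_mkcond.
transitivity (\int[mu]_x (k (F t x) * D x)%:E)%E.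
  apply: eq_integral => x _; rewrite patchE /k indicE.
  have -> : (F t x \in F (- t) @^-1` B) = (x \in B).
    by apply/idP/idP; rewrite !inE/= (flowNK flowF).
  by case: ifP => _; rewrite ?mulr1// mulr0 mul0r.
transitivity (\int[mu]_x (k x)%:E)%E; last first.
  by apply: eq_integral => x _; rewrite patchE /k indicE; case: ifP => _; rewrite ?mulr1 ?mulr0.
apply: (@ge0_integral_weighted_layers _ _ _ _ (k \o F t)) => //= r r0.
rewrite -DE; last first.
  rewrite -[X in measurable X]setTI.
  by apply: measurable_fun_ltr => //; exact: measurable_cst.
congr (mu _); apply/seteqP; split=> [x/= rx|_ [x /= rx <-]//].
by exists (F (- t) x); rewrite /= (flowKN flowF).
Qed.

End transport.

Section setwise.
Context (R : realType) (d : measure_display) (T : measurableType d).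
Variables (mu : {sigma_finite_measure set T -> \bar R}) (F : R -> T -> T).
Hypothesis flowF : nonsingular_flow mu F.

Lemma Rintegral_sum B (I : Type) (s : seq I) (f : I -> T -> R) : measurable B ->
  (forall i, mu.-integrable B (EFin \o f i)) ->
  \int[mu]_(x in B) (\sum_(i <- s) f i x) = \sum_(i <- s) \int[mu]_(x in B) f i x.
Proof.
move=> mB intf; rewrite /Rintegral.
under eq_integral do rewrite -sumEFin.
rewrite (integral_sum mB intf) sum_fine// => i _.
by apply: integrable_fin_num => //; exact: intf.
Qed.

(** An error of eps in the norm of L^1 bounds the error on each measurable set,
    and the integral of each translate over B is the g-mass of F_(t k) B. *)
Lemma approx_setwise (A B : set T) (m : nat) (lam : 'I_m -> R) (t : 'I_m -> R)
    (D : 'I_m -> T -> R) (g : T -> R) (eps : R) :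
  measurable A -> (mu A < +oo)%E -> measurable B -> L1_plus mu g ->
  (forall k, is_RN_derivative mu (fun C => mu (F (t k) @` C)) (D k)) ->
  ('N[mu]_1 [EFin \o (fun x =>
     \1_A x - \sum_(k < m) lam k * g (F (t k) x) * D k x)%R] <= eps%:E)%E ->
  `|fine (mu (A `&` B)) -
    \sum_(k < m) lam k * \int[mu]_(x in F (- t k) @^-1` B) g x| <= eps.
Proof.
move=> mA Aoo mB [/Lfun1_integrable intg g0] DE.
have mg : measurable_fun setT g by apply/measurable_EFinP; case/integrableP: intg.
pose h k x := g (F (t k) x) * D k x.
have int_h k (C : set T) : measurable C -> mu.-integrable C (EFin \o h k).
  move=> mC; apply: (@integrableS _ _ _ mu setT) => //.
  have [mD D0 _] := DE k; apply/integrableP; split.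
    apply/measurable_EFinP; apply: measurable_funM => //.
    by apply: measurableT_comp => //; exact: (measurable_flow flowF).
  under eq_integral do rewrite /= ger0_norm ?mulr_ge0//.
  rewrite (integral_RN_flow flowF (DE k) mg g0 measurableT) preimage_setT.
  have /integrableP[_] := intg.
  by under eq_integral do rewrite /= ger0_norm//.
pose S x := \sum_(k < m) lam k * h k x.
have int_lh k C : measurable C -> mu.-integrable C (EFin \o (fun x => lam k * h k x)).
  move=> mC; rewrite (_ : _ \o _ = fun x => ((lam k)%:E * (EFin \o h k) x)%E)//.
  by apply: integrableZl => //; exact: int_h.
have int_S C : measurable C -> mu.-integrable C (EFin \o S).
  move=> mC; rewrite (_ : _ \o _ = fun x => (\sum_(k < m) (lam k * h k x)%:E)%E); last first.
    by apply/funext => x; rewrite /= sumEFin.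
  by apply: integrable_sum => // k _; exact: int_lh.
have int_A C : measurable C -> mu.-integrable C (EFin \o \1_A).
  move=> mC; apply: (@integrableS _ _ _ mu setT) => //.
  have mI : measurable_fun setT (\1_A : T -> R) by exact: measurable_indic.
  apply/integrableP; split; first exact/measurable_EFinP.
  under eq_integral do rewrite /= ger0_norm//.
  by rewrite integral_indic// setIT.
pose phi x := \1_A x - S x.
have int_phi C : measurable C -> mu.-integrable C (EFin \o phi).
  move=> mC; rewrite (_ : EFin \o phi = (EFin \o \1_A) \- (EFin \o S))%E//.
  by apply: integrableB => //; [exact: int_A|exact: int_S].
rewrite (_ : (fun x => _) = phi); last first.
  by apply/funext => x; rewrite /phi /S; congr (_ - _); apply: eq_bigr => k _; rewrite mulrA.
rewrite Lnorm1 => le_eps.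
have -> : fine (mu (A `&` B)) -
    \sum_(k < m) lam k * \int[mu]_(x in F (- t k) @^-1` B) g x =
    \int[mu]_(x in B) phi x.
  rewrite RintegralB//; [|exact: int_A|exact: int_S].
  congr (_ - _); first by rewrite /Rintegral integral_indic.
  rewrite Rintegral_sum// => [|k]; last exact: int_lh.
  apply: eq_bigr => k _; rewrite RintegralZl//; last exact: int_h.
  by congr (_ * _); rewrite /Rintegral (integral_RN_flow flowF (DE k)).
apply: le_trans (le_normr_Rintegral mB (int_phi _ mB)) _.
rewrite /Rintegral -lee_fin fineK; last first.
  apply: integrable_fin_num => //.
  rewrite (_ : (fun x => _) = abse \o (EFin \o phi))//.
  exact/integrable_abse/int_phi.
apply: le_trans le_eps; apply: ge0_subset_integral => //.
have /integrableP[mphi _] := int_phi _ measurableT.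
exact: (measurableT_comp (@abse_measurable R setT) mphi).
Qed.

End setwise.

(** * Landing times *)

Section mass_counting.
Context (R : realType) (d : measure_display) (T : measurableType d).
Variables (mu : {sigma_finite_measure set T -> \bar R}) (F : R -> T -> T).
Hypothesis flowF : nonsingular_flow mu F.
Variables (g : T -> R) (m : nat) (lam t : 'I_m -> R).
Hypotheses (g_L1 : L1_plus mu g) (lam0 : forall k, 0 <= lam k).

Definition mass (B : set T) : R := \int[mu]_(x in B) g x.

Let int_g B : measurable B -> mu.-integrable B (EFin \o g).
Proof.
by case: g_L1 => /Lfun1_integrable intg _ mB; apply: integrableS intg.
Qed.

Lemma mass_ge0 B : 0 <= mass B.
Proof. by case: g_L1 => _ g0; apply: Rintegral_ge0. Qed.

Lemma massU B C : measurable B -> measurable C -> mass (B `|` C) <= mass B + mass C.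
Proof.
move=> mB mC; have mCB : measurable (C `\` B) by exact: measurableD.
have BCB : B `|` C = B `|` (C `\` B) by rewrite setDE setUIr setUv setIT.
have C1 : C = (C `&` B) `|` (C `\` B) by rewrite setUIDK.
have dis X Y : X `&` Y = set0 -> [disjoint X & Y] by move=> XY; apply/disj_setPS; rewrite XY.
rewrite /mass BCB Rintegral_setU//; last 2 first.
- by apply: int_g; exact: measurableU.
- by apply: dis; rewrite setDE setICA setICr setI0.
rewrite lerD2l [in leRHS]C1 Rintegral_setU//.
- by rewrite lerDr; exact: mass_ge0.
- exact: measurableI.
- by rewrite -C1; exact: int_g.
- by apply: dis; rewrite setDE setIACA setICr setI0.
Qed.

(** Used with X1 and X2 carrying most of the mass: then Y carries a definite part
    of it. *)
Lemma mass_capture X1 X2 Y : measurable X1 -> measurable X2 -> measurable Y ->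
  X1 `&` X2 `<=` Y -> mass setT <= mass Y + mass (~` X1) + mass (~` X2).
Proof.
move=> mX1 mX2 mY XY; have mC1 := measurableC mX1; have mC2 := measurableC mX2.
have -> : [set: T] = Y `|` ~` X1 `|` ~` X2.
  apply/seteqP; split => // x _.
  have [x1|x1] := pselect (X1 x); last by left; right.
  by have [x2|x2] := pselect (X2 x); [left; left; exact: XY|right].
apply: le_trans (massU _ mC2) _; first exact: measurableU.
by rewrite lerD2r; exact: massU.
Qed.

(** What remains of the approximation of the indicator of A by the combination
    of the translates of g with weights lam k, once tested on measurable sets. *)
Definition approximates (eps : R) (A : set T) : Prop :=
  forall B, measurable B -> `|fine (mu (A `&` B)) -
    \sum_(k < m) lam k * mass (F (- t k) @^-1` B)| <= eps.

(** At least three quarters of the translate by c lie in A; two conditions of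
    this kind hold together on half of the mass of g. *)
Definition lands (A : set T) (c : R) : bool :=
  4 * mass (F (- c) @^-1` (~` A)) <= mass setT.

Lemma lands_sub A B c : measurable A -> measurable B -> A `<=` B ->
  lands A c -> lands B c.
Proof.
move=> mA mB AB; apply: le_trans; rewrite ler_pM2l//.
have mp C : measurable C -> measurable (F (- c) @^-1` (~` C)).
  by move=> mC; apply: (measurable_flow_preimage flowF); exact: measurableC.
have [_ g0] := g_L1.
have fin C : measurable C -> (\int[mu]_(x in F (- c) @^-1` (~` C)) (g x)%:E)%E \is a fin_num.
  by move=> /mp mC; exact: (integrable_fin_num mC (int_g mC)).
apply: fine_le; [exact: fin|exact: fin|].
apply: ge0_subset_integral => //; try exact: mp.
- by case/integrableP: (int_g (mp _ mA)).
- by move=> x _; rewrite lee_fin.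
- by apply: preimage_subset; exact: subsetC.
Qed.

(** The part of the translates outside A has total weight at most eps, and a
    time that does not land in A puts a quarter of its translate there, so such
    times weigh at most 4 eps.  The remaining eps comes from the total weight. *)
Lemma lands_mass A eps : measurable A -> approximates eps A ->
  fine (mu A) - 5 * eps <= \sum_(k < m | lands A (t k)) lam k * mass setT.
Proof.
move=> mA approx; have := approx _ measurableT.
rewrite setIT; under eq_bigr do rewrite preimage_setT.
rewrite (bigID (fun k => lands A (t k)))/=.
have := approx _ (measurableC mA).
rewrite setICr measure0 sub0r normrN (bigID (fun k => lands A (t k)))/=.
set bad := \sum_(k < m | ~~ _) lam k * mass (F _ @^-1` _).
set badT := \sum_(k < m | ~~ _) lam k * mass setT.
set good := \sum_(k < m | lands A _) lam k * mass (F _ @^-1` _).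
have good0 : 0 <= good by apply: sumr_ge0 => k _; rewrite mulr_ge0// mass_ge0.
have badle : badT <= 4 * bad.
  rewrite mulr_sumr; apply: ler_sum => k; rewrite /lands -ltNge => lt.
  by rewrite mulrCA ler_wpM2l// ltW.
rewrite !ler_norml => /andP[_ h1] /andP[_ h2]; move: h1 h2 badle good0.
move: (fine _) (\sum_(k < m | lands A _) lam k * mass setT) => a b.
by move: bad badT good => x y z; lra.
Qed.

(** For each k in P, half of the mass of g sits at points x such that
    F_(-t k) x is in A1 and reaches F_(-c) x in A after the time t k - c, whose
    size is in the window of scale s.  So half of the translate by t k lies in
    L, where the translates together have weight at most mu L + eps. *)
Lemma annulus_mass (A A1 L : set T) (eps c s : R) (P : pred 'I_m) :
  measurable A -> measurable A1 -> measurable L -> A1 `<=` A ->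
  approximates eps A1 -> Lambda F 1 s A `<=` L -> (mu L <= eps%:E)%E ->
  lands A c ->
  (forall k, P k -> lands A1 (t k) /\ expR (s - 1) < `|t k - c| < expR (s + 1)) ->
  \sum_(k < m | P k) lam k * mass setT <= 4 * eps.
Proof.
move=> mA mA1 mL A1A approx LL muL landc ann.
have half k : P k -> mass setT <= 2 * mass (F (- t k) @^-1` L).
  move=> /ann[landk /andP[lo hi]].
  have mp u C : measurable C -> measurable (F u @^-1` C).
    exact: (measurable_flow_preimage flowF).
  have := @mass_capture (F (- t k) @^-1` A1) (F (- c) @^-1` A) (F (- t k) @^-1` L)
    (mp _ _ mA1) (mp _ _ mA) (mp _ _ mL).
  have preC u C : F u @^-1` (~` C) = ~` (F u @^-1` C) by [].
  move: landk landc; rewrite /lands !preC.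
  set w := mass setT; set x1 := mass (~` (F (- t k) @^-1` A1)).
  set x2 := mass (~` (F (- c) @^-1` A)); set y := mass (F (- t k) @^-1` L).
  move: w x1 x2 y => w x1 x2 y l1 l2 capt.
  suff : w <= y + x1 + x2 by lra.
  apply: capt => {w x1 x2 y l1 l2}.
  move=> x [/= xA1 xA]; apply: LL; split; first exact: A1A.
  exists (t k - c); last by rewrite -(flowD flowF) addrC addrA addNr add0r.
  have [tc|tc] := leP 0 (t k - c).
    by left; rewrite /= in_itv/= -(ger0_norm tc) lo hi.
  by right; rewrite /= in_itv/= -{1 2}[t k - c]opprK -(ltr0_norm tc) !ltrN2 lo hi.
have le2 : \sum_(k < m | P k) lam k * mass setT <=
    2 * \sum_(k < m) lam k * mass (F (- t k) @^-1` L).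
  rewrite mulr_sumr (bigID P predT)/= -[leLHS]addr0 lerD//.
    by apply: ler_sum => k Pk; rewrite mulrCA ler_wpM2l//; exact: half.
  by apply: sumr_ge0 => k _; rewrite !mulr_ge0// mass_ge0.
have := approx _ mL; rewrite ler_distl => /andP[+ _].
have : fine (mu (A1 `&` L)) <= eps.
  have le : (mu (A1 `&` L) <= eps%:E)%E.
    apply: le_trans muL; apply: le_measure; rewrite ?inE//.
    exact: measurableI.
  by rewrite -lee_fin fineK// ge0_fin_numE// (le_lt_trans le)// ltry.
move: le2; move: (fine _) (\sum_(k < m) lam k * mass _) => x y.
by move: (\sum_(k < m | P k) _) => z; lra.
Qed.

End mass_counting.

(** * Property B against approximate transitivity *)

(** Property B passes to subsets, so its set may be taken of finite measure, as
    mu is sigma-finite. *)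
Lemma sparse_returns (R : realType) d (T : measurableType d)
    (mu : {sigma_finite_measure set T -> \bar R}) (F : R -> T -> T) :
  property_B mu F ->
  exists A : set T, [/\ measurable A, (0 < mu A)%E, (mu A < +oo)%E &
    forall delta eps : R, 0 < delta -> 0 < eps -> exists s0 : R, forall s, s0 < s ->
      exists L, [/\ measurable L, Lambda F delta s A `<=` L & (mu L < eps%:E)%E]].
Proof.
move=> [A [mA A0 lim0]].
have [S ST /= mS] := sigma_finiteT mu.
have [n An] : exists n, (0 < mu (A `&` S n))%E.
  apply: contrapT => no; move: A0; rewrite lt_neqAle => /andP[/eqP + _]; apply.
  have Sn n : mu (A `&` S n) = 0%E.
    apply/eqP; rewrite eq_le measure_ge0 andbT leNgt; apply/negP => lt.
    by apply: no; exists n.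
  apply/esym/negligibleP => //; rewrite -(setIT A) ST setI_bigcupr.
  apply: negligible_bigcup => n; apply/negligibleP; last exact: Sn.
  exact: measurableI mA (mS n).1.
exists (A `&` S n); split => //; first exact: measurableI mA (mS n).1.
  apply: le_lt_trans (mS n).2; apply: le_measure; rewrite ?inE//.
    exact: measurableI mA (mS n).1.
  exact: (mS n).1.
move=> delta eps delta0 eps0.
have : (limf_esup (fun s : R => mu_ext mu (Lambda F delta s A)) (pinfty_nbhs R) < eps%:E)%E.
  by rewrite (lim0 _ delta0) lte_fin.
rewrite limf_esupE => /ereal_inf_lt[_ [V [s0 [_ s0V]] <-] supV].
exists s0 => s /s0V Vs.
have [L [mL AL muL]] : exists L, [/\ measurable L, Lambda F delta s A `<=` L & (mu L < eps%:E)%E].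
  apply: mu_ext_lt_cover; apply: le_lt_trans supV; apply: ereal_sup_ubound.
  by exists s.
exists L; split => // x [[Ax _] [t tI [At _]]]; apply: AL; split => //; by exists t.
Qed.

Lemma approximates_two (R : realType) d (T : measurableType d)
    (mu : {sigma_finite_measure set T -> \bar R}) (F : R -> T -> T)
    (A1 A2 : set T) (eps : R) :
  nonsingular_flow mu F -> approximately_transitive mu F ->
  measurable A1 -> measurable A2 -> (mu A1 < +oo)%E -> (mu A2 < +oo)%E -> 0 < eps ->
  exists (g : T -> R) (m : nat) (t lam1 lam2 : 'I_m -> R),
    [/\ L1_plus mu g, forall k, 0 <= lam1 k, forall k, 0 <= lam2 k,
        approximates mu F g lam1 t eps A1 & approximates mu F g lam2 t eps A2].
Proof.
move=> flowF AT mA1 mA2 oo1 oo2 eps0.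
pose A (j : 'I_2) := if j == ord0 then A1 else A2.
have mA j : measurable (A j) by rewrite /A; case: ifP.
have Aoo j : (mu (A j) < +oo)%E by rewrite /A; case: ifP.
have L1A j : L1_plus mu (\1_(A j)).
  split=> [|x]; last by [].
  apply/Lfun1_integrable/integrableP; split.
    by apply/measurable_EFinP; apply: measurable_indic.
  under eq_integral do rewrite /= ger0_norm//.
  rewrite integral_indic// setIT; exact: Aoo.
have [g [m [t [lam [D [g1 _ lam0 DE le]]]]]] := AT 2 (fun j => \1_(A j)) eps isT L1A eps0.
exists g, m, t, (lam ord0), (lam ord_max); split => // B mB.
  exact: (approx_setwise flowF (mA ord0) (Aoo ord0) mB g1 DE (le ord0)).
exact: (approx_setwise flowF (mA ord_max) (Aoo ord_max) mB g1 DE (le ord_max)).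
Qed.

(** If the translates by c1 and c2 are mostly in A1 and A2, some point of A1
    reaches A2 after the time c1 - c2. *)
Lemma lands_close (R : realType) d (T : measurableType d)
    (mu : {sigma_finite_measure set T -> \bar R}) (F : R -> T -> T) (g : T -> R)
    (A1 A2 : set T) (c1 c2 M : R) :
  nonsingular_flow mu F -> L1_plus mu g -> measurable A1 -> measurable A2 ->
  (forall x u, A1 x -> A2 (F u x) -> M < `|u|) -> 0 < mass mu g setT ->
  lands mu F g A1 c1 -> lands mu F g A2 c2 -> M < `|c1 - c2|.
Proof.
move=> flowF g1 mA1 mA2 far g0 land1 land2; rewrite ltNge; apply/negP => close.
have mp u C : measurable C -> measurable (F u @^-1` C).
  exact: (measurable_flow_preimage flowF).
have := mass_capture g1 (mp (- c1) _ mA1) (mp (- c2) _ mA2) measurable0.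
rewrite {2}/mass Rintegral_set0 add0r => capt.
have preC u C : F u @^-1` (~` C) = ~` (F u @^-1` C) by [].
have {capt} : mass mu g setT <= mass mu g (~` (F (- c1) @^-1` A1)) +
    mass mu g (~` (F (- c2) @^-1` A2)).
  apply: capt => x [/= x1 x2].
  have := far _ (c1 - c2) x1; rewrite -(flowD flowF) addrC addrA addNr add0r.
  by move=> /(_ x2); rewrite ltNge close.
move: g0 land1 land2; rewrite /lands !preC.
set w := mass mu g setT; set x1 := mass mu g (~` (F (- c1) @^-1` A1)).
set x2 := mass mu g (~` (F (- c2) @^-1` A2)).
by move: w x1 x2 => w x1 x2; lra.
Qed.

Theorem corollary4p3 (R : realType) (d : measure_display)
    (T : measurableType d) (mu : {sigma_finite_measure set T -> \bar R})
    (F : R -> T -> T) :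
  standard_borel R T ->
  nonsingular_flow mu F ->
  properly_ergodic mu F ->
  property_B mu F ->
  ~ approximately_transitive mu F.
Proof.
move=> stdT flowF ergF /sparse_returns[A [mA A0 Aoo sparse]] AT.
have finE B : measurable B -> B `<=` A -> mu B = (fine (mu B))%:E.
  move=> mB BA; rewrite fineK// ge0_fin_numE//; apply: le_lt_trans Aoo.
  by apply: le_measure; rewrite ?inE.
have [a muA] : exists a, mu A = a%:E by exists (fine (mu A)); exact: finE.
have a0 : 0 < a by rewrite -lte_fin -muA.
(* The final comparison needs (a - eps) / 3 - 5 eps > 8 eps. *)
have [eps epsE] : exists eps, 100 * eps = a by exists (a / 100); rewrite mulrC divfK.
have eps0 : 0 < eps by lra.
have [s0 sparse0] := sparse 1 eps ltr01 eps0.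
have e2 : 2 < expR 1 :> R by have := @expR_gt1Dx R 1 (oner_neq0 _); rewrite -natr1 //.
(* The window of scale s0 + 2 is ]M, e^2 M[, and it contains ]M, 2 M]. *)
pose M := expR (s0 + 1); have M0 : 0 < M := expR_gt0 _.
have [L [mL AL muL]] := sparse0 (s0 + 2) ltac:(lra).
pose E := A `\` L.
have mE : measurable E by exact: measurableD.
have EA : E `<=` A by move=> x [].
have gap x t : E x -> E (F t x) -> `|t| <= 2 * M -> `|t| <= M.
  move=> [Ax Lx] [At _] t2M; rewrite leNgt; apply/negP => Mt; apply/Lx/AL.
  have tlo : expR (s0 + 2 - 1) < `|t| by rewrite (_ : s0 + 2 - 1 = s0 + 1)//; ring.
  have thi : `|t| < expR (s0 + 2 + 1).
    apply: le_lt_trans t2M _.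
    rewrite (_ : s0 + 2 + 1 = 1 + 1 + (s0 + 1)); last by ring.
    rewrite expRD -/M ltr_pM2r// expRD.
    by have := ltr_pM _ _ e2 e2; nra.
  split => //; exists t => //; have [t0|t0] := leP 0 t.
    by left; rewrite /= in_itv/= -(ger0_norm t0) tlo thi.
  by right; rewrite /= in_itv/= -{1 2}[t]opprK -(ltr0_norm t0) !ltrN2 tlo thi.
have Eoo : (mu E < +oo)%E by rewrite finE// ltry.
have [A1 [A2 [[mA1 mA2] [A1E A2E] A13 A23 far]]] := split_clusters flowF ergF stdT M0 mE Eoo gap.
have A1A : A1 `<=` A by move=> x /A1E/EA.
have A2A : A2 `<=` A by move=> x /A2E/EA.
have aE : a <= fine (mu E) + eps.
  have : (mu A <= mu E + eps%:E)%E.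
    rewrite (measureDI mu mA mL) -/E; apply: leeD => //.
    apply: le_trans (ltW muL); apply: le_measure; rewrite ?inE//.
    exact: measurableI.
  by rewrite muA (finE E)// -EFinD lee_fin.
have big B : measurable B -> B `<=` A -> (mu E <= 3%:E * mu B)%E -> 33 * eps <= fine (mu B).
  move=> mB BA; rewrite [X in (X <= _)%E](finE E)// [X in (_ * X)%E](finE B)//.
  rewrite -EFinM lee_fin => le3; move: aE le3.
  by move: (fine (mu E)) (fine (mu B)) => x y; lra.
have {A13}bigA1 := big _ mA1 A1A A13; have {A23}bigA2 := big _ mA2 A2A A23.
have lt_oo B : measurable B -> B `<=` A -> (mu B < +oo)%E by move=> *; rewrite finE// ltry.
have [g [m [t [lam1 [lam2 [g1 lam10 lam20 app1 app2]]]]]] :=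
  approximates_two flowF AT mA1 mA2 (lt_oo _ mA1 A1A) (lt_oo _ mA2 A2A) eps0.
have good1 := lands_mass g1 lam10 mA1 app1.
have good2 := lands_mass g1 lam20 mA2 app2.
have [r landr] : exists r, lands mu F g A2 (t r).
  apply: contrapT => no; move: good2; rewrite big_pred0 => [|k].
    by move: bigA2; move: (fine _) => x; lra.
  by apply/negP => lk; apply: no; exists k.
have [k1 land1] : exists k, lands mu F g A1 (t k).
  apply: contrapT => no; move: good1; rewrite big_pred0 => [|k].
    by move: bigA1; move: (fine _) => x; lra.
  by apply/negP => lk; apply: no; exists k.
have mass0 : 0 < mass mu g setT.
  rewrite lt_neqAle mass_ge0// andbT; apply/negP => /eqP z.
  move: good1; rewrite big1 => [|k _]; last by rewrite -z mulr0.
  by move: bigA1; move: (fine _) => x; lra.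
have [k0 land0 max0] := @arg_maxP _ _ _ k1 (fun k => lands mu F g A1 (t k))
  (fun k => `|t k - t r|) land1.
have [dist distE] : exists dist, dist = `|t k0 - t r| by eexists.
rewrite -distE in max0.
have Mdist : M < dist by rewrite distE; exact: lands_close flowF g1 mA1 mA2 far mass0 land0 landr.
have dist0 : 0 < dist := lt_trans M0 Mdist.
have s0dist : s0 < ln dist.
  have : s0 + 1 < ln dist by rewrite -(expRK (s0 + 1)) ltr_ln ?posrE.
  by lra.
have [L' [mL' AL' muL']] := sparse0 _ s0dist.
have lo : expR (ln dist - 1) < dist / 2.
  rewrite expRD lnK ?posrE// expRN ltr_pM2l// ltf_pV2 ?posrE ?expR_gt0//.
have hi : 2 * dist < expR (ln dist + 1).
  by rewrite expRD lnK ?posrE// mulrC ltr_pM2l.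
(* Times landing in A1 that are far from t r are in the annulus around t r; those
   near t r are in the annulus around t k0. *)
have annr := @annulus_mass _ _ _ mu F flowF g m lam1 t g1 lam10 A A1 L' eps (t r) (ln dist)
  (fun k => lands mu F g A1 (t k) && (dist / 2 <= `|t k - t r|)) mA mA1 mL' A1A app1 AL' (ltW muL').
have ann0 := @annulus_mass _ _ _ mu F flowF g m lam1 t g1 lam10 A A1 L' eps (t k0) (ln dist)
  (fun k => lands mu F g A1 (t k) && ~~ (dist / 2 <= `|t k - t r|)) mA mA1 mL' A1A app1 AL' (ltW muL').
have landAr := lands_sub flowF g1 mA2 mA A2A landr.
have landA0 := lands_sub flowF g1 mA1 mA A1A land0.
have {}annr := annr landAr _; have {}ann0 := ann0 landA0 _.
have : 33 * eps - 5 * eps <= 4 * eps + 4 * eps.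
  apply: (@le_trans _ _ (fine (mu A1) - 5 * eps)); first by rewrite lerD2r.
  apply: le_trans good1 _.
  rewrite (bigID (fun k => dist / 2 <= `|t k - t r|))/=; apply: lerD.
    apply: annr => k /andP[landk far_r]; split => //.
    rewrite (lt_le_trans lo)//=; apply: le_lt_trans hi.
    by apply: le_trans (max0 k landk) _; lra.
  apply: ann0 => k /andP[landk]; rewrite -ltNge => near_r; split => //.
  have tri := ler_normB (t k - t r) (t k - t k0).
  rewrite (_ : t k - t r - (t k - t k0) = t k0 - t r) -?distE in tri; last by ring.
  have := ler_normB (t k - t r) (t k0 - t r).
  rewrite (_ : t k - t r - (t k0 - t r) = t k - t k0) -?distE; last by ring.
  by move: tri near_r lo hi; move: `|t k - t r| `|t k - t k0| => x y ? ? ? ? ?; apply/andP; split; lra.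
by lra.
Qed.
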